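(* Let $f:[a,b]\to[c,d]$ be absolutely continuous on $[a,b]$ with $f'(x)\neq 0$ for $\lambda$-almost every $x\in[a,b]$, and let $G:[c,d]\to\mathbb{R}$ be Riemann integrable on $[c,d]$. Then the composition $h=G\circ f$ is Riemann integrable on $[a,b]$.
   Context: Here $a<b$ and $c<d$ are real numbers and $\lambda$ is Lebesgue measure on $\mathbb{R}$. The condition on $f'$ means that there is a $\lambda$-null set $N\subset[a,b]$ such that for every $x\in[a,b]\setminus N$ the derivative $f'(x)$ exists and is nonzero. *)

(* Defs.v *)
From mathcomp Require Import all_boot all_order all_algebra.
From mathcomp Require Import all_classical all_reals all_analysis.

Set Implicit Arguments.
Unset Strict Implicit.
Unset Printing Implicit Defensive.

Import Order.TTheory GRing.Theory Num.Theory.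
Import numFieldNormedType.Exports.

Local Open Scope classical_set_scope.
Local Open Scope ring_scope.

(* Only the values of [f] on [[a, b]] matter.  The component intervals may
   share endpoints: disjointness is required of the open intervals. *)
Definition absolutely_continuous_on (R : realType) (a b : R) (f : R -> R) :
    Prop :=
  forall e : R, 0 < e -> exists2 delta : R, 0 < delta &
    forall (n : nat) (u v : 'I_n -> R),
      (forall i, a <= u i /\ u i < v i /\ v i <= b) ->
      trivIset [set: 'I_n] (fun i => `]u i, v i[%classic) ->
      \sum_(i < n) (v i - u i) < delta ->
      \sum_(i < n) `|f (v i) - f (u i)| < e.

(* Main.v *)
Require Import Defs.
From mathcomp Require Import all_boot all_order all_algebra.
From mathcomp Require Import all_classical all_reals all_analysis.
From mathcomp Require Import Rstruct Rstruct_topology.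
From mathcomp Require Import measurable_realfun ring lra.
From Stdlib Require Import Rdefinitions.
From Stdlib Require RiemannInt_SF RiemannInt.
From Coquelicot Require Hierarchy RInt Rcomplements SF_seq.

Import Order.TTheory GRing.Theory Num.Theory.
Import numFieldNormedType.Exports.

Local Open Scope classical_set_scope.
Local Open Scope ring_scope.

(** Riemann integrability of a bounded function is governed by the size of its
    set of discontinuities, and the composition inherits its discontinuities
    from [G] through [f]: as [f] is continuous, [G \o f] can oscillate by more
    than [e] at [x] only if [G] oscillates by more than [e] at [f x].  So it
    is enough that the preimage under [f] of a null set is null, and this is
    exactly what a nonvanishing derivative provides.

    Preimages of null sets ([negligible_preimage]).  Where [f' x != 0] there
    is an [n] with [|y - x| <= n |f y - f x|] for all [y] within [1/n] of [x].
    Sorting such points by [n] and by the cell of length [1/n] that contains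
    them gives countably many pieces on each of which [f] has a Lipschitz
    inverse.  A Lipschitz map sends null sets to null sets, so a piece that
    [f] maps into a null set is null.

    Lebesgue's criterion is then used in both directions, one oscillation
    threshold [e] at a time.

    From integrability to null sets ([oscillation_negligible]).  If a step
    function [phi] is within a step function [psi] of [G], then away from
    the finitely many jumps the oscillation of [G] is at most [2 psi], and by
    Markov's inequality the set where [psi > e / 2] has measure at most
    [2 / e] times the integral of [psi], which can be made arbitrarily small.

    From null sets to integrability ([ex_RInt_of_oscillation]).  Cover the
    points where [h] oscillates by more than [e] by an open set [U] of small
    measure.  Around a point of [U] use a bound [M] on [|h|], elsewhere
    the value of [h] there up to [e]; glueing such local bounds along [[a, b]]
    sandwiches [h] between integrable functions whose integrals differ by at
    most twice [e (b - a) + M mu(U)]. *)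

(** * Null sets and functions with Lipschitz inverse *)

Lemma negligible_of_small_covers (R : realType) (N : set R) :
  (forall eta : R, 0 < eta ->
     exists2 B : set R, N `<=` B & (lebesgue_measure B <= eta%:E)%E) ->
  (@lebesgue_measure R).-negligible N.
Proof.
move=> smallN; apply/negligible_outer_measure/eqP.
rewrite eq_le outer_measure_ge0 andbT; apply/lee_addgt0Pr => eta eta0.
have [B NB muB] := smallN _ eta0; rewrite add0e.
by apply: le_trans muB; exact: le_outer_measure.
Qed.

(** The factor [2] avoids computing the infimum of [S]: a set of diameter [r]
    lies in the closed ball of radius [r] around any of its points. *)
Lemma lebesgue_measure_le_diam (R : realType) (S : set R) (r : R) :
  0 <= r -> (forall x y, S x -> S y -> `|y - x| <= r) ->
  (lebesgue_measure S <= (2 * r)%:E)%E.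
Proof.
move=> r0 Sr; have [[x Sx]|] := pselect (exists x, S x); last first.
  move=> S0; have -> : S = set0.
    by apply/seteqP; split => // x Sx; case: S0; exists x.
  by rewrite measure0 lee_fin mulr_ge0.
apply: (@le_trans _ _ (lebesgue_measure `[x - r, x + r]%classic)).
  apply: le_outer_measure => y Sy /=; rewrite in_itv /=.
  by have := Sr _ _ Sx Sy; rewrite ler_norml; lra.
rewrite lebesgue_measure_itv /=; case: ifP => _; last first.
  by rewrite lee_fin mulr_ge0.
by rewrite -EFinB lee_fin; lra.
Qed.

(** The hypothesis says that [f] is injective on [T] with a [K]-Lipschitz
    inverse.  If intervals [J k] cover [Z], then the part of [T] that [f] sends
    into [J k] has diameter at most [K] times the length of [J k], and these
    parts cover [T]. *)
Lemma negligible_of_expanding (R : realType) (f : R -> R) (T Z : set R)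
    (K : R) :
  0 < K -> (forall x y, T x -> T y -> `|y - x| <= K * `|f y - f x|) ->
  T `<=` f @^-1` Z -> (@lebesgue_measure R).-negligible Z ->
  (@lebesgue_measure R).-negligible T.
Proof.
move=> K0 KT TZ /negligible_outer_measure Z0.
apply: negligible_of_small_covers => eta eta0; exists T => //.
have e0 : 0 < eta / (2 * K) by rewrite divr_gt0 // mulr_gt0.
have : (ereal_inf [set \sum_(k <oo) wlength idfun (F k)
                  | F in (open_itv_cover Z : set (nat -> set R))]
         < (eta / (2 * K))%:E)%E.
  by rewrite -outer_measure_open_itv_cover Z0 lte_fin.
move=> /ereal_inf_lt [_ /= [J [Jitv ZJ] <-] Jlt].
have J_ge0 k : (0 <= wlength idfun (J k))%E.
  by have [[u v] ->] := Jitv k; apply: wlength_ge0.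
have piece k :
    (lebesgue_measure (T `&` f @^-1` J k)
       <= (2 * K)%:E * wlength idfun (J k))%E.
  have [[u v] /= Juv] := Jitv k.
  have [uv|vu] := ltP u v; last first.
    have -> : T `&` f @^-1` J k = set0.
      apply/seteqP; split => // x [_] /=; rewrite Juv /= in_itv /=; lra.
    by rewrite measure0 mule_ge0 // lee_fin mulr_ge0 // ltW.
  rewrite Juv wlength_itv /= lte_fin uv -EFinB -EFinM -mulrA.
  have uv0 : 0 <= v - u by lra.
  apply: lebesgue_measure_le_diam; first by rewrite mulr_ge0 // ltW.
  move=> x y [Tx /=]; rewrite in_itv /= => /andP[fx1 fx2].
  move=> [Ty /=]; rewrite in_itv /= => /andP[fy1 fy2].
  apply: le_trans (KT _ _ Tx Ty) _; rewrite ler_pM2l // ler_norml; lra.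
have TU : T `<=` \bigcup_k (T `&` f @^-1` J k).
  by move=> x Tx; have [k _ Jk] := ZJ _ (TZ _ Tx); exists k.
apply: (@le_trans _ _ (\sum_(k <oo) (lebesgue_measure (T `&` f @^-1` J k)))%E).
  apply: (@le_trans _ _ (lebesgue_measure (\bigcup_k (T `&` f @^-1` J k)))).
    exact: le_outer_measure.
  exact: outer_measure_sigma_subadditive.
apply: (@le_trans _ _ (\sum_(k <oo) ((2 * K)%:E * wlength idfun (J k)))%E).
  by apply: lee_nneseries => *.
rewrite nneseriesZl //.
have K20 : 0 < 2 * K by rewrite mulr_gt0.
by rewrite muleC -lee_pdivlMr // -EFinM; apply: ltW.
Qed.

(** Near [x] the difference quotients exceed half of [|f' x|]; a single integer
    serves both as the expansion constant and as the inverse of the radius, so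
    that the points can later be sorted by one countable index. *)
Lemma locally_expanding (R : realType) (f : R^o -> R^o) (x : R) :
  derivable f x 1 -> f^`()%classic x != 0 ->
  exists n : nat, forall y : R, `|y - x| < n.+1%:R^-1 ->
    `|y - x| <= n.+1%:R * `|f y - f x|.
Proof.
move=> df f'0.
pose l := `|f^`()%classic x|; have l0 : 0 < l by rewrite normr_gt0.
have cv : (h^-1 *: (f (h + x) - f x) @[h --> 0^'] --> f^`()%classic x).
  move: (df); rewrite /derivable derive1E /derive.
  rewrite (_ : (fun h : R => _) = (fun h : R => h^-1 *: (f (h + x) - f x))) //.
  by apply/funext => h; rewrite /GRing.scale /= mulr1.
have /cvgrPdist_lt /(_ (l / 2)) := cv.
have l20 : 0 < l / 2 by rewrite divr_gt0.
move=> /(_ l20) /nbhs_ballP[r /= r0 rP].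
have m0 : 0 < Num.min r (l / 2) by rewrite lt_min r0.
have [n] := ltr_add_invr m0; rewrite add0r lt_min => /andP[nr nl].
exists n => y yx.
have [->|yNx] := eqVneq y x; first by rewrite subrr normr0 mulr_ge0.
have d0 : 0 < `|y - x| by rewrite normr_gt0 subr_eq0.
have : `|f^`()%classic x - (y - x)^-1 *: (f (y - x + x) - f x)| < l / 2.
  apply: rP; last by rewrite subr_eq0.
  by rewrite /ball /= sub0r normrN (lt_trans yx).
rewrite subrK /GRing.scale /= => dist.
have : l / 2 < `|(y - x)^-1 * (f y - f x)|.
  have := lerB_normD (f^`()%classic x) (- ((y - x)^-1 * (f y - f x))).
  rewrite normrN -/l; lra.
rewrite normrM normfV => /(lt_trans nl)/ltW.
have n0 : 0 < n.+1%:R :> R by [].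
by rewrite ler_pdivlMl // mulrC ler_pdivrMl.
Qed.

(** A cell [T n j] has diameter less than [1 / (n + 1)], the radius in which
    the expansion bound with constant [n + 1] is available, so that bound holds
    between any two of its points. *)
Lemma negligible_preimage (R : realType) (f : R^o -> R^o) (Z : set R) :
  (@lebesgue_measure R).-negligible Z ->
  (@lebesgue_measure R).-negligible
    [set x | [/\ derivable f x 1, f^`()%classic x != 0 & Z (f x)]].
Proof.
move=> Z0.
pose T (n : nat) (j : int) : set R := [set x | [/\ Z (f x),
  forall y : R, `|y - x| < n.+1%:R^-1 -> `|y - x| <= n.+1%:R * `|f y - f x| &
  Num.floor (x * n.+1%:R) = j]].
have T0 n j : (@lebesgue_measure R).-negligible (T n j).
  apply: (@negligible_of_expanding _ f _ Z n.+1%:R) => //; last by move=> x [].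
  move=> x y [_ Tx xj] [_ _ yj]; apply: Tx.
  rewrite -[X in _ < X]mul1r ltr_pdivlMr //.
  rewrite -[X in _ * X](@gtr0_norm _ n.+1%:R) //.
  rewrite -normrM mulrBl ltr_norml.
  have := floor_itv (x * n.+1%:R); have := floor_itv (y * n.+1%:R).
  rewrite xj yj intrD; lra.
pose F m := if @unpickle (nat * int)%type m is Some (n, j) then T n j else set0.
have : (@lebesgue_measure R).-negligible (\bigcup_m F m).
  apply: negligible_bigcup => m; rewrite /F.
  by case: unpickle => [[n j]|]; [exact: T0|exact: negligible_set0].
apply: negligibleS => x [df f'0 Zfx].
have [n nP] := @locally_expanding R f x df f'0.
exists (pickle (n, Num.floor (x * n.+1%:R))) => //.
by rewrite /F pickleK.
Qed.

(** * Glueing local bounds along an interval *)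

(** Cousin's lemma in predicate form.  The supremum [m] of the [t] with [P a t]
    is reached from some [t] in the neighbourhood of [m] where [P] holds, and
    the same neighbourhood would carry the supremum past [m] if [m < b]. *)
Lemma additive_interval_induction (R : realType) (a b : R)
    (P : R -> R -> Prop) :
  a <= b ->
  (forall s t u, a <= s -> s <= t -> t <= u -> u <= b ->
     P s t -> P t u -> P s u) ->
  (forall x, a <= x <= b -> exists2 r : R, 0 < r &
     forall s t, a <= s -> x - r < s -> s <= x -> x <= t -> t < x + r ->
       t <= b -> P s t) ->
  P a b.
Proof.
move=> ab add loc.
pose E : set R := [set t | a <= t <= b /\ P a t].
have Ea : E a.
  split; first by rewrite lexx.
  have [|r r0 rP] := loc a; first by rewrite lexx.
  by apply: rP => //; lra.
have ubE : has_ubound E by exists b => t [/andP[]].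
have supE : has_sup E by split => //; exists a.
set m := sup E.
have am : a <= m by exact: ub_le_sup.
have mb : m <= b by apply: ge_sup; [exists a|move=> t [/andP[]]].
have [|r r0 rP] := loc m; first by rewrite am.
have [t [/andP[at_ tb] Pat] mt] := sup_adherent r0 supE.
have tm : t <= m by apply: ub_le_sup => //; split => //; rewrite at_.
have Pext u : m <= u -> u < m + r -> u <= b -> P a u.
  move=> mu ur ub; apply: (add a t u) => //; first exact: le_trans mu.
  by apply: rP.
have [bm|bm] := leP b (m + r / 2); first by apply: Pext => //; lra.
have : E (m + r / 2).
  by split; [lra|apply: Pext; lra].
move=> /(ub_le_sup ubE); rewrite -/m; lra.
Qed.

Local Notation is_RIntR := (@RInt.is_RInt Hierarchy.R_NormedModule).


(** The Riemann sums of [h] differ from those of [phi] by at most those of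
    [psi], so for fine subdivisions they all lie within a small distance of
    [I]: they satisfy Cauchy's criterion. *)
Lemma ex_RInt_of_sandwich (h : R -> R) (a b : R) : a < b ->
  (forall eps : R, 0 < eps -> exists (phi psi : R -> R) (I J : R),
     [/\ is_RIntR phi a b I, is_RIntR psi a b J, J < eps &
      forall x : R, a <= x <= b -> `|h x - phi x| <= psi x]) ->
  @RInt.ex_RInt Hierarchy.R_NormedModule h a b.
Proof.
move=> ab sandwich.
(* The filter defining the integral carries the sign of [b - a]. *)
have sgn : Rcomplements.sign (Rminus b a) = 1.
  apply: Rcomplements.sign_eq_1; apply/Rcomplements.Rlt_minus_r/RltP.
  by rewrite RplusE add0r.
pose RS (f : R -> R) ptd : R :=
  @SF_seq.Riemann_sum Hierarchy.R_ModuleSpace f ptd.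
have signE (x : R) : @Hierarchy.scal Hierarchy.R_Ring Hierarchy.R_ModuleSpace
    (Rcomplements.sign (Rminus b a)) x = x.
  by rewrite sgn; exact: mul1r.
have fine_filter : Hierarchy.Filter (SF_seq.Riemann_fine a b).
  exact: Hierarchy.filter_filter.
have fine_imp (P Q : SF_seq.SF_seq -> Prop) : (forall ptd, P ptd -> Q ptd) ->
    SF_seq.Riemann_fine a b P -> SF_seq.Riemann_fine a b Q.
  exact: Hierarchy.filter_imp.
have near_int (f : R -> R) (l e : R) : 0 < e -> is_RIntR f a b l ->
    SF_seq.Riemann_fine a b (fun ptd => `|RS f ptd - l| < e).
  move=> /RltP e0 fl.
  have := fl _ (@Hierarchy.locally_ball Hierarchy.R_UniformSpace l
                  (RIneq.mkposreal e e0)).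
  apply: fine_imp => ptd.
  rewrite -[RS f ptd]signE -RabsE => H; exact/RltP/H.
apply: (proj1 (@Hierarchy.filterlim_locally_cauchy _
  Hierarchy.R_CompleteSpace _ (SF_seq.Riemann_fine_filter a b) _)).
move=> [eps epsP]; have /RltP eps0 := epsP.
have e80 : 0 < eps / 8 by rewrite divr_gt0.
have [phi [psi [I [J [phiI psiJ Jeps hphi]]]]] := sandwich _ e80.
exists (fun ptd => `|RS h ptd - I| < eps / 2); split; last first.
  move=> u v hu hv.
  suff : `|RS h v - RS h u| < eps.
    rewrite -{1}[RS h v]signE -{1}[RS h u]signE -RabsE => /RltP; exact.
  move: hu hv; rewrite !ltr_norml; lra.
have : SF_seq.Riemann_fine a b
    (fun ptd => `|RS h ptd - RS phi ptd| <= RS psi ptd).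
  rewrite /SF_seq.Riemann_fine /Hierarchy.within.
  apply Hierarchy.filter_forall => ptd [pt [sh sl]].
  have := @SF_seq.Riemann_sum_norm Hierarchy.R_NormedModule
    (fun x => h x - phi x) psi ptd pt.
  rewrite (SF_seq.Riemann_sum_minus (V := Hierarchy.R_ModuleSpace) h phi) sl sh.
  have /RleP abR := ltW ab.
  rewrite Rbasic_fun.Rmin_left // Rbasic_fun.Rmax_right // => H.
  apply/RleP; rewrite -RabsE; apply: H => t [/RleP ta /RleP tb].
  by apply/RleP; rewrite /Hierarchy.norm /= /Hierarchy.abs /= RabsE hphi // ta.
move=> hsum; have := @Hierarchy.filter_and _ _ fine_filter _ _ hsum
  (@Hierarchy.filter_and _ _ fine_filter _ _
  (near_int _ _ _ e80 phiI) (near_int _ _ _ e80 psiJ)).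
apply: fine_imp => ptd [h1 [h2 h3]].
move: h1 h2 h3; rewrite !ler_norml !ltr_norml; lra.
Qed.

(** [w] bounds half of the gap between an upper and a lower integral of [h]. *)
Definition sandwiched (h : R -> R) (s t w : R) : Prop :=
  exists (phi psi : R -> R) (I J : R),
    [/\ is_RIntR phi s t I, is_RIntR psi s t J, J <= w &
     forall x : R, s <= x <= t -> `|h x - phi x| <= psi x].

Lemma sandwiched_const (h : R -> R) (s t c e : R) :
  (forall x : R, s <= x <= t -> `|h x - c| <= e) ->
  sandwiched h s t (e * (t - s)).
Proof.
move=> hc; exists (fun=> c), (fun=> e), ((t - s) * c), ((t - s) * e).
split=> //.
- exact: (@RInt.is_RInt_const Hierarchy.R_NormedModule s t c).
- exact: (@RInt.is_RInt_const Hierarchy.R_NormedModule s t e).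
- by rewrite mulrC.
Qed.

Lemma sandwiched_le (h : R -> R) (s t w w' : R) :
  w <= w' -> sandwiched h s t w -> sandwiched h s t w'.
Proof.
move=> ww' [phi [psi [I [J [? ? Jw ?]]]]]; exists phi, psi, I, J; split => //.
exact: le_trans ww'.
Qed.

Lemma is_RInt_glue (f g : R -> R) (s t u I J : R) : s <= t -> t <= u ->
  is_RIntR f s t I -> is_RIntR g t u J ->
  is_RIntR (fun x => if x <= t then f x else g x) s u (I + J).
Proof.
move=> /RleP st /RleP tu fI gJ.
apply: (@RInt.is_RInt_Chasles Hierarchy.R_NormedModule _ s t u).
  apply: RInt.is_RInt_ext fI => x.
  rewrite Rbasic_fun.Rmin_left // Rbasic_fun.Rmax_right // => -[_ /RltP xt].
  by rewrite ltW.
apply: RInt.is_RInt_ext gJ => x.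
rewrite Rbasic_fun.Rmin_left // Rbasic_fun.Rmax_right // => -[/RltP tx _].
by rewrite leNgt tx.
Qed.

Lemma sandwiched_glue (h : R -> R) (s t u w w' : R) : s <= t -> t <= u ->
  sandwiched h s t w -> sandwiched h t u w' -> sandwiched h s u (w + w').
Proof.
move=> st tu [phi [psi [I [J [phiI psiJ Jw hst]]]]].
move=> [phi' [psi' [I' [J' [phiI' psiJ' Jw' htu]]]]].
exists (fun x => if x <= t then phi x else phi' x).
exists (fun x => if x <= t then psi x else psi' x), (I + I'), (J + J').
split; [exact: is_RInt_glue|exact: is_RInt_glue|exact: lerD|].
move=> x /andP[sx xu]; have [xt|tx] := leP x t; first by apply: hst; rewrite sx.
by apply: htu; rewrite xu ltW.
Qed.

(** * Lebesgue's criterion: null oscillation sets give integrability *)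

(** The deviation is measured from [h x] itself, on both sides within [[a, b]];
    the union of these sets over [e > 0] is the set of discontinuities of the
    restriction of [h] to [[a, b]]. *)
Definition oscillating {R : realType} (h : R -> R) (a b e : R) : set R :=
  [set x | a <= x <= b /\ forall r, 0 < r ->
     exists y, [/\ a <= y <= b, `|y - x| < r & e < `|h y - h x|]].

(** The bound [w s t] charges [e] per unit of length plus [M] per unit of
    length inside [U].  It is additive in the interval, so it suffices to
    establish it near each point: inside [U] the constant [0] approximates [h]
    up to [M], and outside [U] the value [h x] does up to [e]. *)
Lemma ex_RInt_of_oscillation (h : R -> R) (a b M : R) : a < b -> 0 < M ->
  (forall x : R, a <= x <= b -> `|h x| <= M) ->
  (forall e : R, 0 < e ->
     (@lebesgue_measure R).-negligible (oscillating h a b e)) ->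
  @RInt.ex_RInt Hierarchy.R_NormedModule h a b.
Proof.
move=> ab M0 hM osc0; apply: ex_RInt_of_sandwich => // eps eps0.
pose mu := @lebesgue_measure R.
pose e := eps / (4 * (b - a)).
have ba0 : 0 < b - a by rewrite subr_gt0.
have e0 : 0 < e by rewrite divr_gt0 // mulr_gt0.
have eta0 : 0 < eps / (4 * M) by rewrite divr_gt0 // mulr_gt0.
have [U [oU oscU muU]] := outer_measure_open_le (oscillating h a b e) eta0.
rewrite (proj1 (negligible_outer_measure _) (osc0 _ e0)) add0e in muU.
have mU : measurable U by exact: open_measurable.
(* Half-open intervals make [w] exactly additive. *)
pose w s t := e * (t - s) + M * fine (mu (U `&` `]s, t])).
have finU s t : (mu (U `&` `]s, t]) <= (eps / (4 * M))%:E)%E.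
  by apply: le_trans muU; apply: le_outer_measure => x [].
have fin_numU s t : mu (U `&` `]s, t]) \is a fin_num.
  by rewrite ge0_fin_numE //; apply: le_lt_trans (finU s t) _; rewrite ltry.
have w_add s t u : s <= t -> t <= u -> w s t + w t u = w s u.
  move=> st tu.
  have -> : w s u = e * (u - s) + M * (fine (mu (U `&` `]s, t])) +
                                   fine (mu (U `&` `]t, u]))).
    rewrite /w -fineD //; congr (_ + _ * fine _).
    rewrite -measureU //.
    - rewrite -setIUr; congr (mu (_ `&` _)); apply/seteqP; split => x /=;
      rewrite !in_itv /=.
        move=> /andP[sx xu]; have [xt|tx] := leP x t; [left|right]; lra.
      by case; lra.
    - by apply: measurableI.
    - by apply: measurableI.
    - by apply/seteqP; split => // x [[_ /=]] + [_ /=]; rewrite !in_itv /=; lra.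
  rewrite /w; lra.
have : sandwiched h a b (w a b).
  apply: (@additive_interval_induction R a b
            (fun s t => sandwiched h s t (w s t))).
  - exact: ltW.
  - move=> s t u _ st tu _ hst htu; rewrite -(w_add s t u) //.
    exact: sandwiched_glue hst htu.
  move=> x axb; have [Ux|nUx] := pselect (U x).
    have /nbhs_ballP[r /= r0 rU] := open_nbhs_nbhs (conj oU Ux).
    exists r => // s t as_ rs sx xt tr tb.
    have -> : w s t = e * (t - s) + M * (t - s).
      rewrite /w (_ : U `&` `]s, t] = `]s, t]%classic).
        rewrite /mu lebesgue_measure_itv /= lte_fin.
        case: ltP => [st|ts] /=; first by [].
        by have -> : t - s = 0 by lra.
      apply/seteqP; split => [y []//|y sty]; split => //; apply: rU.
      move: sty; rewrite /ball /= in_itv /= ltr_norml; lra.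
    apply: (@sandwiched_le _ _ _ (M * (t - s))).
      by rewrite lerDr mulr_ge0 ?(ltW e0) //; lra.
    apply: (@sandwiched_const _ _ _ 0) => y /andP[sy yt].
    by rewrite subr0; apply: hM; lra.
  have [r r0 rP] : exists2 r : R, 0 < r & forall y : R,
      a <= y <= b -> `|y - x| < r -> `|h y - h x| <= e.
    apply: contrapT => noR; apply: nUx; apply: oscU; split => // r r0.
    apply: contrapT => noY; apply: noR; exists r => // y ayb yxr.
    by rewrite leNgt; apply/negP => ?; apply: noY; exists y.
  exists r => // s t as_ rs sx xt tr tb.
  apply: (@sandwiched_le _ _ _ (e * (t - s))).
    by rewrite lerDl mulr_ge0 ?fine_ge0 ?(ltW M0).
  apply: (@sandwiched_const _ _ _ (h x)) => y syt; apply: rP; first lra.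
  by rewrite ltr_norml; lra.
move=> [phi [psi [I [J [phiI psiJ Jw hs]]]]].
exists phi, psi, I, J; split => //; apply: le_lt_trans Jw _; rewrite /w.
have -> : e * (b - a) = eps / 4 by rewrite /e; field; lra.
have : M * fine (mu (U `&` `]a, b])) <= M * (eps / (4 * M)).
  by rewrite ler_pM2l // -lee_fin fineK.
have -> : M * (eps / (4 * M)) = eps / 4 by field; lra.
lra.
Qed.

(** * Lebesgue's criterion: integrability gives null oscillation sets *)

(** Peels the leftmost interval off a subdivision.  Here [l] lists the nodes
    and [lf] the values on the open intervals between them, while the value of
    [f] at a node is unconstrained. *)
Lemma adapted_couple_ind (P : R -> seq R -> seq R -> Prop)
    (f : R -> R) (b : R) :
  P b [:: b] [::] ->
  (forall (r1 r2 c : R) (l lf : seq R), r1 <= r2 -> r2 <= b ->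
     (forall x : R, r1 < x < r2 -> f x = c) ->
     RiemannInt_SF.adapted_couple f r2 b (r2 :: l) lf ->
     P r2 (r2 :: l) lf -> P r1 [:: r1, r2 & l] (c :: lf)) ->
  forall (l lf : seq R) (a : R), a <= b ->
  RiemannInt_SF.adapted_couple f a b l lf -> P a l lf.
Proof.
move=> P0 Pcons; elim=> [|r1 l IH] lf a ab H.
  by case: H => _ [_ [_ []]].
have /RleP abR := ab.
have ar1 : r1 = a.
  by case: H => _ [/= -> _]; rewrite Rbasic_fun.Rmin_left.
rewrite ar1 in H *.
case: l IH H => [|r2 l] IH H.
  case: H => _ [_ [/= + [+ _]]]; rewrite Rbasic_fun.Rmax_right // => ->.
  by case: lf.
case: lf H => [|c lf] H.
  by case: H => _ [_ [_ []]].
have H' := RiemannInt_SF.StepFun_P7 abR H.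
have r12 : a <= r2.
  by case: H => /(_ 0%N) ord _; apply/RleP; apply: ord; exact/ssrnat.ltP.
have r2b : r2 <= b.
  case: H => ord [_ [last_b _]]; apply/RleP.
  rewrite -(Rbasic_fun.Rmax_right _ _ abR) -last_b.
  by apply: RList.RList_P7 => //; right; left.
apply: Pcons => //; last exact: IH.
move=> x /andP[/RltP ax /RltP xr2].
case: H => _ [_ [_ [_ /(_ 0%N)]]]; apply; first exact/ssrnat.ltP.
by split.
Qed.

Lemma step_function_locally_constant (f : R -> R) (a b : R) (l lf : seq R) :
  a <= b -> RiemannInt_SF.adapted_couple f a b l lf ->
  forall x : R, a <= x <= b -> x \notin l ->
  exists2 r : R, 0 < r & forall y : R, `|y - x| < r -> f y = f x.
Proof.
move=> ab H; move: l lf a ab H.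
apply: (@adapted_couple_ind (fun a l _ => forall x : R, a <= x <= b ->
  x \notin l -> exists2 r : R, 0 < r &
    forall y : R, `|y - x| < r -> f y = f x)).
  by move=> x /le_anti <-; rewrite inE eqxx.
move=> r1 r2 c l lf r12 r2b fc _ IH x xb.
rewrite inE negb_or => /andP[xr1 xl].
have [r2x|] := leP r2 x; first by apply: IH => //; lra.
move=> xr2; have r1x : r1 < x by rewrite lt_neqAle eq_sym xr1; lra.
exists (Num.min (x - r1) (r2 - x)); first by rewrite lt_min !subr_gt0 r1x.
move=> y; rewrite lt_min !ltr_norml => yx.
by rewrite !fc //; lra.
Qed.

Definition superlevel (f : R -> R) (a b e : R) : set R :=
  [set x | a <= x <= b /\ e < f x].

(** Each interval where the value exceeds [e] contributes at least [e] times
    its length to the integral, and the nodes have measure zero. *)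
Lemma step_function_markov (f : R -> R) (a b e : R) (l lf : seq R) :
  a <= b -> RiemannInt_SF.adapted_couple f a b l lf -> 0 < e ->
  (forall x : R, a <= x <= b -> 0 <= f x) ->
  (lebesgue_measure (superlevel f a b e)
     <= (RiemannInt_SF.Int_SF lf l / e)%:E)%E.
Proof.
move=> ab H e0; move: l lf a ab H.
pose S a := superlevel f a b e.
apply: (@adapted_couple_ind (fun a l lf =>
  (forall x : R, a <= x <= b -> 0 <= f x) ->
  (lebesgue_measure (S a) <= (RiemannInt_SF.Int_SF lf l / e)%:E)%E)).
  move=> _; apply: (@le_trans _ _ (lebesgue_measure [set b])).
    by apply: le_outer_measure => x [xb _] /=; apply/esym/le_anti.
  by rewrite lebesgue_measure_set1 lee_fin mul0r.
move=> r1 r2 c l lf r12 r2b fc _ IH f0 /=.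
pose C := if e < c then `]r1, r2[%classic else set0 : set R.
have SU : S r1 `<=` C `|` ([set r1] `|` S r2).
  move=> x [xb ex].
  have [xr1|xr1] := eqVneq x r1; first by right; left.
  have [r2x|xr2] := leP r2 x.
    by right; right; split => //; lra.
  have r1x : r1 < x by rewrite lt_neqAle eq_sym xr1; lra.
  left; rewrite /C -(fc x) ?ex ?r1x //=.
  by rewrite in_itv /= r1x.
have muC : (lebesgue_measure C <= (c * (r2 - r1) / e)%:E)%E.
  rewrite /C; case: ltP => [ec|ce].
    rewrite lebesgue_measure_itv /= lte_fin; case: ltP => r.
      by rewrite -EFinB lee_fin ler_pdivlMr // mulrC ler_wpM2r //; lra.
    by rewrite (_ : r2 - r1 = 0) ?mulr0 ?mul0r //; lra.
  rewrite measure0 lee_fin; apply: divr_ge0; last exact: ltW.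
  have [r|r] := ltP r1 r2; last first.
    by rewrite (_ : r2 - r1 = 0) ?mulr0 //; lra.
  apply: mulr_ge0; last lra.
  rewrite -(fc ((r1 + r2) / 2)); first by apply: f0; lra.
  by lra.
rewrite RplusE RmultE RminusE mulrDl EFinD.
apply: (@le_trans _ _ (lebesgue_measure C + (lebesgue_measure [set r1] +
    lebesgue_measure (S r2)))%E).
  apply: (@le_trans _ _ (lebesgue_measure (C `|` ([set r1] `|` S r2)))).
    exact: le_outer_measure.
  apply: le_trans (outer_measureU2 _ _ _) _.
  by rewrite leeD2l //; exact: outer_measureU2.
rewrite lebesgue_measure_set1 add0e leeD //.
by apply: IH => x xb; apply: f0; lra.
Qed.

(** Outside the nodes of [phi] and [psi] both are locally constant, so
    [|G y - G x| <= psi y + psi x = 2 psi x] for [y] close to [x]; thus [G] can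
    oscillate by more than [e] only where [psi > e / 2]. *)
Lemma oscillation_negligible (G : R -> R) (c d e : R) : c <= d -> 0 < e ->
  @RInt.ex_RInt Hierarchy.R_NormedModule G c d ->
  (@lebesgue_measure R).-negligible (oscillating G c d e).
Proof.
move=> cd e0 /RInt.ex_RInt_Reals_0 Gint; have /RleP cdR := cd.
apply: negligible_of_small_covers => eta eta0.
(* The integral of [psi] that Markov's inequality turns into [eta]. *)
have m0 : 0 < eta * (e / 2) by rewrite mulr_gt0 // divr_gt0.
have /RltP m0R := m0.
have [phi [psi [Gphi]]] := Gint (RIneq.mkposreal _ m0R).
rewrite RabsE => /RltP /= psi_small.
have Gphi' (x : R) : c <= x <= d ->
    `|G x - RiemannInt_SF.fe phi x| <= RiemannInt_SF.fe psi x.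
  move=> /andP[/RleP cx /RleP xd]; apply/RleP; rewrite -RabsE; apply: Gphi.
  by rewrite Rbasic_fun.Rmin_left // Rbasic_fun.Rmax_right.
have Hphi := RiemannInt_SF.StepFun_P1 phi.
have Hpsi := RiemannInt_SF.StepFun_P1 psi.
set lphi := RiemannInt_SF.subdivision phi in Hphi.
set lpsi := RiemannInt_SF.subdivision psi in Hpsi.
pose S := superlevel (RiemannInt_SF.fe psi) c d (e / 2).
exists ([set` lphi ++ lpsi] `|` S).
  move=> x [xcd osc]; apply: contrapT => xB.
  have xl : x \notin lphi ++ lpsi by apply/negP => xl; apply: xB; left.
  have psi_e : RiemannInt_SF.fe psi x <= e / 2.
    by rewrite leNgt; apply/negP => ex; apply: xB; right.
  move: xl; rewrite mem_cat negb_or => /andP[xphi xpsi].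
  have [r r0 rP] := step_function_locally_constant _ _ _ _ _ cd Hphi _ xcd xphi.
  have [r' r'0 r'P] :=
    step_function_locally_constant _ _ _ _ _ cd Hpsi _ xcd xpsi.
  have [|y [ycd]] := osc (Num.min r r'); first by rewrite lt_min r0.
  rewrite lt_min => /andP[yr yr'].
  rewrite ltNge => /negP; apply.
  have := Gphi' _ xcd; have := Gphi' _ ycd.
  rewrite rP // r'P //.
  by rewrite !ler_norml; lra.
apply: (@le_trans _ _ (lebesgue_measure [set` lphi ++ lpsi] +
  lebesgue_measure S)%E); first exact: outer_measureU2.
rewrite countable_lebesgue_measure0 ?add0e; last first.
  by apply: finite_set_countable; exact: finite_seq.
have e20 : 0 < e / 2 by rewrite divr_gt0.
have psi0 (x : R) : c <= x <= d -> 0 <= RiemannInt_SF.fe psi x.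
  by move=> xcd; apply: le_trans (Gphi' x xcd).
apply: le_trans (step_function_markov _ _ _ _ _ _ cd Hpsi e20 psi0) _.
rewrite lee_fin ler_pdivrMr //.
move: psi_small; rewrite /RiemannInt_SF.RiemannInt_SF.
by case: RIneq.Rle_dec => // _ /ltW; apply: le_trans; exact: ler_norm.
Qed.

(** * The composition *)

Lemma ex_RInt_bounded (h : R -> R) (a b : R) :
  a <= b -> @RInt.ex_RInt Hierarchy.R_NormedModule h a b ->
  exists2 M : R, 0 < M & forall x : R, a <= x <= b -> `|h x| <= M.
Proof.
move=> /RleP ab /RInt.ex_RInt_ub[M].
rewrite Rbasic_fun.Rmin_left // Rbasic_fun.Rmax_right // => hM.
exists (`|M| + 1) => [|x /andP[/RleP ax /RleP xb]].
  by rewrite ltr_wpDl.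
have := hM x (conj ax xb); rewrite /Hierarchy.norm /= /Hierarchy.abs /=.
rewrite RabsE => /RleP hx; have := ler_norm M; lra.
Qed.

(** Continuity is the case of a single interval in the definition. *)
Lemma absolutely_continuous_on_continuous (a b : R) (f : R -> R) (x e : R) :
  absolutely_continuous_on a b f -> a <= x <= b -> 0 < e ->
  exists2 r : R, 0 < r & forall y : R, a <= y <= b -> `|y - x| < r ->
    `|f y - f x| < e.
Proof.
move=> f_ac xab e0; have [r r0 rP] := f_ac _ e0; exists r => // y yab yxr.
have one (u v : R) : a <= u -> u < v -> v <= b -> v - u < r -> `|f v - f u| < e.
  move=> au uv vb vur.
  have := rP 1%N (fun=> u) (fun=> v); rewrite !big_ord1; apply => //.
  by move=> i j _ _ _; rewrite !ord1.
move: yxr; rewrite ltr_norml => yxr.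
have [xy|yx|->] := ltgtP x y; last by rewrite subrr normr0.
  by apply: one; lra.
by rewrite distrC; apply: one; lra.
Qed.

Theorem theorem3p1 (a b c d : R) (f G : R -> R)
  (hab : a < b) (hcd : c < d)
  (f_maps : forall x : R, x \in `[a, b] -> f x \in `[c, d])
  (f_ac : absolutely_continuous_on a b f)
  (f_deriv : {ae (@lebesgue_measure R), forall x : R,
      x \in `[a, b] ->
      derivable (f : R^o -> R^o) x 1 /\ (f : R^o -> R^o)^`()%classic x != 0})
  (G_int : @RInt.ex_RInt Hierarchy.R_NormedModule G c d) :
  @RInt.ex_RInt Hierarchy.R_NormedModule (G \o f) a b.
Proof.
have fcd (x : R) : a <= x <= b -> c <= f x <= d.
  by move=> xab; have := f_maps x; rewrite !in_itv /= => /(_ xab).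
have [M M0 GM] := ex_RInt_bounded _ _ _ (ltW hcd) G_int.
apply: (@ex_RInt_of_oscillation _ _ _ M) => // [x xab|e e0].
  by apply: GM; exact: fcd.
have Z0 := oscillation_negligible _ _ _ _ (ltW hcd) e0 G_int.
have E0 := negligible_preimage _ (f : R^o -> R^o) _ Z0.
apply: negligibleS (negligibleU f_deriv E0) => x [xab osc].
have [/(_ _)[|df f'0]|nf'] := pselect (x \in `[a, b] ->
    derivable (f : R^o -> R^o) x 1 /\ (f : R^o -> R^o)^`()%classic x != 0);
  [by rewrite in_itv|right; split => //|by left].
split; first exact: fcd.
move=> r r0.
have [r' r'0 fcont] :=
  absolutely_continuous_on_continuous _ _ _ _ _ f_ac xab r0.
have [y [yab yxr Gfy]] := osc _ r'0.
by exists (f y); split; [exact: fcd|exact: fcont|].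
Qed.
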